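(* Let $T$ be a tree with maximum degree $\Delta(T)$. If $\varphi$ is an edge precoloring of $\Delta(T)$ edges of $T \square K_2$ using colors from $\{1,\dots,\Delta(T)+1\}$, then $\varphi$ can be extended to a proper $(\Delta(T)+1)$-edge coloring of $T \square K_2$.
   Context: $G \square H$ denotes the cartesian product of graphs $G$ and $H$. An edge precoloring (partial edge coloring) of a graph is a proper edge coloring of some subset of its edges (adjacent precolored edges receive distinct colors). A precoloring $\varphi$ is extended by a proper $t$-edge coloring $f$ (colors $\{1,\dots,t\}$) if $f(e)=\varphi(e)$ for every edge $e$ colored under $\varphi$. *)

(* Defs.v *)
From mathcomp Require Import all_boot.

Set Implicit Arguments.
Unset Strict Implicit.
Unset Printing Implicit Defensive.

(** Finite simple graphs. *)

Record sgraph := SGraph {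
  svertex :> finType;
  sedge : rel svertex;
  sg_sym : symmetric sedge;
  sg_irrefl : irreflexive sedge }.

Definition max_degree (G : sgraph) : nat :=
  \max_(x : G) #|[set y | sedge x y]|.

(** Since [ucycle e [:: x; y]] holds along any single edge, the graph-theoretic
    cycles are the [ucycle]s of size at least 3. *)
Definition acyclic (G : sgraph) : Prop :=
  forall c : seq G, ucycle (@sedge G) c -> size c < 3.

Definition connected (G : sgraph) : Prop :=
  0 < #|G| /\ forall x y : G, connect (@sedge G) x y.

Definition is_tree (G : sgraph) : Prop := connected G /\ acyclic G.

Section Complete.
Variable n : nat.

Definition complete_rel : rel 'I_n := fun i j => i != j.

Fact complete_sym : symmetric complete_rel.
Proof. by move=> i j; rewrite /complete_rel eq_sym. Qed.

Fact complete_irrefl : irreflexive complete_rel.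
Proof. by move=> i; rewrite /complete_rel eqxx. Qed.

Definition complete : sgraph := SGraph complete_sym complete_irrefl.

End Complete.

Section CartesianProduct.
Variables G H : sgraph.

Definition cartesian_rel : rel (G * H) := fun p q =>
  (p.1 == q.1) && sedge p.2 q.2 || sedge p.1 q.1 && (p.2 == q.2).

Fact cartesian_sym : symmetric cartesian_rel.
Proof.
move=> p q; rewrite /cartesian_rel (eq_sym p.1) (eq_sym p.2).
by rewrite (sg_sym p.1) (sg_sym p.2).
Qed.

Fact cartesian_irrefl : irreflexive cartesian_rel.
Proof. by move=> p; rewrite /cartesian_rel !sg_irrefl andbF. Qed.

Definition cartesian : sgraph := SGraph cartesian_sym cartesian_irrefl.

End CartesianProduct.

Notation "''K_' n" := (complete n) (at level 8, n at level 2, format "''K_' n").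
Notation "G □ H" := (cartesian G H) (at level 40, left associativity).

(** Edges are the unordered pairs of adjacent vertices. *)

Definition edges (G : sgraph) : {set {set G}} :=
  [set [set p.1; p.2] | p : G * G & sedge p.1 p.2].

Definition edge (G : sgraph) : finType := {e : {set G} | e \in edges G}.

Definition adjacent_edges (G : sgraph) (e1 e2 : edge G) : bool :=
  (e1 != e2) && (val e1 :&: val e2 != set0).

(** The colors 1, ..., t are represented by the elements 0, ..., t - 1 of
    ['I_t]. *)

Definition proper_edge_coloring (G : sgraph) (t : nat) (f : edge G -> 'I_t) :
    Prop :=
  forall e1 e2, adjacent_edges e1 e2 -> f e1 != f e2.

(** In a partial coloring, [None] marks the edges that are not precolored. *)

Definition precolored (G : sgraph) (t : nat) (phi : edge G -> option 'I_t) :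
    {set edge G} :=
  [set e | phi e != None].

Definition edge_precoloring (G : sgraph) (t : nat)
    (phi : edge G -> option 'I_t) : Prop :=
  forall e1 e2, e1 \in precolored phi -> e2 \in precolored phi ->
    adjacent_edges e1 e2 -> phi e1 != phi e2.

Definition extends (G : sgraph) (t : nat) (f : edge G -> 'I_t)
    (phi : edge G -> option 'I_t) : Prop :=
  forall e c, phi e = Some c -> f e = c.

(* Main.v *)
(** Write D for the maximum degree and root T at a vertex r. A coloring of the
    prism amounts to choosing, for every star (a vertex x of T, the edge between
    its two copies, and both copies of the tree edges at x), a color c for the
    vertical edge and two injections of the tree edges at x into the other D
    colors; consecutive stars only share the two copies of one tree edge. So the
    coloring is built star by star away from r, and each time the precolored
    edges at the next level forbid some colors. Once c is fixed, a layer of the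
    star is a matching in a complete bipartite graph K_(m, n), m <= n, with
    fewer than n edges removed, which always exists. Let weight(y) count the
    precolored edges hanging below y. A pair of colors for the two copies of the
    edge above y extends below y as soon as it does not clash at y and weight(y)
    plus the number of distinct colors in the pair is at most D. This is
    automatic for a child y of weight at most D - 2; if some child has larger
    weight, then all other constraints at x nearly vanish and both layers can be
    colored alike. At the root this works when r is a vertex whose two copies
    meet the largest number of precolored edges. *)
Require Import Defs.
From mathcomp Require Import all_boot zify.

Set Implicit Arguments.
Unset Strict Implicit.
Unset Printing Implicit Defensive.

(** * Injections avoiding forbidden pairs *)

(** Greedy induction on [#|X|]. Start with an element [u] in a forbidden pair, if there is one; each
    excluded value of [u] costs a pair, so some value [t] is left. Deleting [u] and [t] loses one
    value but also a forbidden pair, so the strict bound survives. *)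
Lemma injection_avoiding (S C : finType) (X : {set S}) (Y : {set C})
    (B : {set S * C}) :
  #|X| <= #|Y| -> X != set0 -> #|B :&: setX X Y| < #|Y| ->
  exists g : S -> C, [/\ {in X &, injective g}, {in X, forall u, g u \in Y}
    & {in X, forall u, (u, g u) \notin B}].
Proof.
move: {2}#|X| (leqnn #|X|) => n; elim: n X Y => [|n IHn] X Y leXn leXY X0 ltB.
  by case/negP: X0; rewrite -cards_eq0 -leqn0.
have [u [uX uB]] : exists u, u \in X /\
    (B :&: setX X Y != set0 -> exists t, (u, t) \in B :&: setX X Y).
  have [->|[[u t] ut]] := set_0Vmem (B :&: setX X Y).
    by case/set0Pn: X0 => u uX; exists u; rewrite eqxx.
  by exists u; split; [move: ut; rewrite !inE => /and3P[] | exists t].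
have [t tY utB] : exists2 t, t \in Y & (u, t) \notin B.
  apply/exists_inP; rewrite -[X in is_true X]negbK; apply/negP => /exists_inPn all_B.
  move: ltB; rewrite ltnNge => /negP; apply.
  rewrite -(@card_imset _ _ (pair u)) => [|x y []//].
  apply/subset_leq_card/subsetP => _ /imsetP[y yY ->].
  by rewrite !inE uX yY; move: (all_B y yY); rewrite negbK => ->.
have cX := cardsD1 u X; have cY := cardsD1 t Y; rewrite uX in cX; rewrite tY in cY.
have [X1|X1] := eqVneq (X :\ u) set0.
  have Xu v : v \in X -> v = u.
    move=> vX; apply/eqP; apply: contraFT (in_set0 v) => vu.
    by rewrite -X1 !inE vu.
  exists (fun=> t); split=> [v w /Xu-> /Xu->|//|v /Xu->//].
  by [].
have [g [gI gY gB]] : exists g : S -> C, [/\ {in X :\ u &, injective g},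
    {in X :\ u, forall v, g v \in Y :\ t} & {in X :\ u, forall v, (v, g v) \notin B}].
  apply: IHn => //; [lia | lia |].
  have sub : B :&: setX (X :\ u) (Y :\ t) \subset B :&: setX X Y.
    by apply: setIS; apply: setXS; apply: subD1set.
  have [e|/uB[s us]] := eqVneq (B :&: setX X Y) set0.
    move: sub; rewrite e subset0 => /eqP->; rewrite cards0.
    by move: X1; rewrite -card_gt0; lia.
  have : #|B :&: setX (X :\ u) (Y :\ t)| < #|B :&: setX X Y|.
    apply: proper_card; rewrite properE sub; apply/subsetPn; exists (u, s) => //.
    by rewrite !inE eqxx /= andbF.
  by lia.
exists (fun v => if v == u then t else g v); split=> [v w vX wX|v vX|v vX] /=.
- have gt x : x \in X -> x != u -> g x != t.
    by move=> xX xu; have := gY x; rewrite !inE xX xu => /(_ isT)/andP[].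
  case: eqP => [->|/eqP vu]; case: eqP => [->|/eqP wu] //.
  + by move=> e; case/eqP: (gt w wX wu).
  + by move=> e; case/eqP: (gt v vX vu).
  + by apply: gI; rewrite !inE ?vu ?wu.
- by case: eqP => // /eqP vu; have := gY v; rewrite !inE vX vu => /(_ isT)/andP[].
- by case: eqP => [->//|/eqP vu]; apply: gB; rewrite !inE vu.
Qed.

Lemma injection_extend (S C : finType) (Z1 Z : {set S}) (g1 : S -> C) :
  #|Z| <= #|C| -> Z1 \subset Z -> {in Z1 &, injective g1} ->
  exists2 g : S -> C, {in Z &, injective g} & {in Z1, g =1 g1}.
Proof.
move=> leZC sZ inj1.
have [Z0|Zn0] := eqVneq (Z :\: Z1) set0.
  have /subsetP sZ1 : Z \subset Z1 by rewrite -setD_eq0 Z0.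
  by exists g1 => // u v /sZ1 uZ /sZ1 vZ; apply: inj1.
have cZ := cardsID Z1 Z; rewrite (setIidPr sZ) in cZ.
have cC := cardsC (g1 @: Z1); rewrite (card_in_imset inj1) in cC.
have leX : #|Z :\: Z1| <= #|~: (g1 @: Z1)| by lia.
have [] := @injection_avoiding _ _ (Z :\: Z1) (~: (g1 @: Z1)) set0 leX Zn0.
  by rewrite set0I cards0; move: Zn0; rewrite -card_gt0; lia.
move=> g [gI gY _].
have gn u v : u \in Z -> u \notin Z1 -> v \in Z1 -> g u <> g1 v.
  move=> uZ uZ1 vZ1 e; have := gY u; rewrite !inE uZ uZ1 e => /(_ isT)/negP[].
  exact: imset_f.
exists (fun u => if u \in Z1 then g1 u else g u) => [u v uZ vZ|u ->//].
case: ifP => uZ1; case: ifP => vZ1.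
- exact: inj1.
- by move=> e; case: (gn v u vZ (negbT vZ1) uZ1).
- by move=> e; case: (gn u v uZ (negbT uZ1) vZ1).
- by apply: gI; rewrite !inE ?uZ1 ?vZ1.
Qed.

(* An item [e] with [fx e] prescribes the color [k e] at [pos e]; the other items
   forbid it there. *)
Lemma row_completion (I S C : finType) (X : {set S}) (A : {set I})
    (fx : pred I) (pos : I -> S) (k : I -> C) (c : C) (d : nat) :
  let F := [set e in A | fx e] in
  let R := [set e in A | ~~ fx e && (k e \notin c |: k @: F)] in
  #|X| <= d -> #|C| = d.+1 -> {in A, forall e, pos e \in X} ->
  {in F &, injective pos} -> {in F &, injective k} ->
  {in F, forall e, k e != c} ->
  {in A &, forall e e', fx e -> ~~ fx e' -> pos e = pos e' -> k e != k e'} ->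
  #|F| + #|R| < d \/ R = set0 ->
  exists g : S -> C, [/\ {in X &, injective g}, {in X, forall u, g u != c}
    & {in A, forall e, (g (pos e) == k e) = fx e}].
Proof.
move=> F R leX cC posX posI kI kc kne few.
(* Prescribed positions and colors are taken out, together with [c]. A forbidden pair whose color is
   gone can no longer be hit, so only [R] counts. *)
pose Y := ~: (c |: k @: F); pose X' := X :\: pos @: F.
have FX : pos @: F \subset X.
  by apply/subsetP=> _ /imsetP[e /setIdP[eA _] ->]; apply: posX.
have cY : #|Y| = d - #|F|.
  have := cardsC (c |: k @: F); rewrite cardsU1 (card_in_imset kI).
  have -> : c \notin k @: F by apply/negP=> /imsetP[e /kc/eqP + e1]; rewrite e1.
  by rewrite -/Y cC /= add1n addSn => -[<-]; rewrite addKn.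
have cX : #|X'| + #|F| = #|X|.
  have := cardsID (pos @: F) X.
  by rewrite (setIidPr FX) (card_in_imset posI) -/X'; lia.
pose B := [set (pos e, k e) | e in [set e in A | ~~ fx e]].
have leB : #|B :&: setX X' Y| <= #|R|.
  rewrite (leq_trans _ (leq_imset_card (fun e => (pos e, k e)) _)) //.
  apply/subset_leq_card/subsetP => _ /setIP[/imsetP[e /setIdP[eA ef] ->]].
  by rewrite !inE /= => /andP[_ ek]; apply: imset_f; rewrite !inE eA ef.
have [g [gI gY gB]] : exists g : S -> C, [/\ {in X' &, injective g},
    {in X', forall u, g u \in Y} & {in X', forall u, (u, g u) \notin B}].
  have [X0|Xn0] := eqVneq X' set0.
    by rewrite X0; exists (fun=> c); split=> u; rewrite in_set0.
  apply: injection_avoiding => //; first by lia.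
  (* As [Y] has [d - #|F|] elements, the first alternative is the bound needed; in the second, [Y]
     is nonempty because a position is left over and [#|X| <= d]. *)
  move: Xn0; rewrite -card_gt0 => Xgt0; apply: leq_ltn_trans leB _.
  by case: few => [lt|->]; rewrite ?cards0; lia.
pose h u := if [pick e in F | pos e == u] is Some e then k e else g u.
have hF e : e \in F -> h (pos e) = k e.
  rewrite /h => eF; case: pickP => [e' /andP[e'F /eqP/posI->]//|/(_ e)].
  by rewrite eF eqxx.
have hX u : u \in X' -> h u = g u.
  rewrite /h => uX; case: pickP => [e /andP[eF /eqP eu]|//].
  by move: uX; rewrite -eu inE (imset_f pos eF).
have XP u : u \in X -> u \in X' \/ exists2 e, e \in F & u = pos e.
  by rewrite /X' inE => ->; case: imsetP => [[e]|]; [right; exists e | left].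
have gF u e : u \in X' -> e \in F -> g u <> k e.
  move=> /gY + eF gu; rewrite !inE gu negb_or => /andP[_ /negP]; apply.
  exact: imset_f.
exists h; split.
- move=> u v /XP[uX|[e eF ->]] /XP[vX|[e' e'F ->]]; rewrite ?hF // ?hX //.
  + exact: gI.
  + by move/gF => /(_ uX e'F).
  + by move/esym/gF => /(_ vX eF).
  + by move/kI->.
- move=> u /XP[uX|[e eF ->]]; rewrite ?hF ?kc // hX //.
  by have := gY u uX; rewrite !inE negb_or => /andP[].
- move=> e eA; case fe: (fx e); first by rewrite hF ?eqxx ?inE ?eA.
  have [uX|[e' e'F eu]] := XP _ (posX e eA).
    rewrite hX //; apply/eqP => ge; have /negP[] := gB _ uX.
    by rewrite ge; apply/imsetP; exists e; rewrite // inE eA fe.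
  have := e'F; rewrite inE => /andP[e'A fe'].
  by rewrite eu hF //; apply/negbTE/kne; rewrite ?fe.
Qed.

(** * Completing one star *)

(** Rows are layers, and [v] is the precoloring of the vertical edge. For [row_completion], each row
    needs fewer than [d] effective items or nothing to forbid. If [v] prescribes a color, then
    [#|A| < d] is enough; otherwise the free choice of [c] has to save one item. *)
Lemma star_completion (L I S C : finType) (X : {set S}) (A : {set I})
    (fx : pred I) (row : L -> pred I) (pos : I -> S) (k : I -> C)
    (v : option C) (d : nat) :
  #|X| <= d -> #|C| = d.+1 -> #|A| + (v != None) <= d ->
  {in A, forall e, pos e \in X} ->
  (forall b, {in A &, forall e e', fx e -> fx e' -> row b e -> row b e' ->
     pos e = pos e' \/ k e = k e' -> e = e'}) ->
  (forall b, {in A &, forall e e', fx e -> ~~ fx e' -> row b e -> row b e' ->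
     pos e = pos e' -> k e != k e'}) ->
  {in A, forall e, fx e -> Some (k e) != v} ->
  exists (c : C) (g : L -> S -> C), (v != None -> v = Some c) /\
   forall b, [/\ {in X &, injective (g b)}, {in X, forall u, g b u != c}
    & {in A, forall e, row b e -> (g b (pos e) == k e) = fx e}].
Proof.
move=> leX cC leA posX fxI fxN fxv.
pose F := [set e in A | fx e].
suff [c [vc cF few]] : exists c, [/\ v != None -> v = Some c,
   {in F, forall e, k e != c} & forall b,
   let Ab := [set e in A | row b e] in let Fb := [set e in Ab | fx e] in
   let R := [set e in Ab | ~~ fx e && (k e \notin c |: k @: Fb)] in
   #|Fb| + #|R| < d \/ R = set0].
  have /fin_all_exists[g gP] : forall b, exists gb : S -> C,
     [/\ {in X &, injective gb}, {in X, forall u, gb u != c}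
      & {in [set e in A | row b e], forall e, (gb (pos e) == k e) = fx e}].
    move=> b; apply: row_completion (few b) => //.
    - by move=> e /setIdP[/posX].
    - move=> e e'; rewrite !inE => /andP[/andP[eA re] fe] /andP[/andP[e'A re'] fe'] pe.
      by apply: fxI re re' _ => //; left.
    - move=> e e'; rewrite !inE => /andP[/andP[eA re] fe] /andP[/andP[e'A re'] fe'] pe.
      by apply: fxI re re' _ => //; right.
    - by move=> e; rewrite !inE => /andP[/andP[eA re] fe]; apply: cF; rewrite inE eA.
    - move=> e e' /setIdP[eA re] /setIdP[e'A re'] fe fe'.
      exact: fxN fe fe' re re'.
  exists c, g; split=> // b; have [? ? gA] := gP b; split=> // e eA re.
  by apply: gA; rewrite inE eA.
have leR b c : let Ab := [set e in A | row b e] in let Fb := [set e in Ab | fx e] in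
   let R := [set e in Ab | ~~ fx e && (k e \notin c |: k @: Fb)] in
   #|Fb| + #|R| <= #|[set e in A | row b e && (fx e || (k e != c))]|.
  move=> Ab Fb R; have FR : Fb :&: R = set0.
    by apply/setP=> e; rewrite !inE; case: (fx e); rewrite ?andbF.
  rewrite -cardsUI FR cards0 addn0; apply/subset_leq_card/subsetP => e; rewrite !inE negb_or.
  by case: (e \in A); case: (row b e); case: (fx e); case: (k e == c).
case: v leA fxv => [c|] leA fxv.
  exists c; split=> // [e /setIdP[eA fe]|b Ab Fb R].
    exact: fxv.
  left; apply: leq_ltn_trans (leR b c) _.
  have : #|[set e in A | row b e && (fx e || (k e != c))]| <= #|A|.
    by apply/subset_leq_card/subsetP => e /setIdP[].
  by move: leA; rewrite /= addn1; lia.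
move: leA; rewrite eqxx addn0 => leA.
(* Giving the vertical edge a color that some item forbids makes that item
   harmless in every layer. *)
have [/exists_inP[e eA /andP[fe ke]]|none] :=
    boolP [exists e in A, ~~ fx e && (k e \notin k @: F)].
  exists (k e); split=> // [e' e'F|b Ab Fb R].
    by apply/negP => /eqP e1; move: ke; rewrite -e1 imset_f.
  left; apply: leq_ltn_trans (leR b _) _.
  have : #|[set e' in A | row b e' && (fx e' || (k e' != k e))]| <= #|A :\ e|.
    apply/subset_leq_card/subsetP => e'; rewrite !inE.
    have [->|_] /= := eqVneq e' e; first by rewrite (negbTE fe) eqxx /= !andbF.
    by case/andP.
  by have := cardsD1 e A; rewrite eA; lia.
(* Now every forbidding color is also prescribed in [A]. With [c] outside all colors in play, a row
   containing all of [A] has empty [R], and any other row misses an item. *)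
have kF : forall e, e \in A -> ~~ fx e -> k e \in k @: F.
  move=> e eA fe; move: none; rewrite negb_exists_in => /forall_inP/(_ e eA).
  by rewrite fe negbK.
have [c cA] : exists c, c \notin k @: A.
  apply/existsP; rewrite -[X in is_true X]negbK; apply/negP => /existsPn all_k.
  have : #|C| <= #|k @: A|.
    apply/subset_leq_card/subsetP => c _.
    by move: (all_k c); rewrite negbK.
  by have := leq_imset_card k A; lia.
exists c; split=> // [e /setIdP[eA fe]|b Ab Fb R].
  by apply/negP => /eqP e1; move: cA; rewrite -e1 imset_f.
have [eA|nA] := eqVneq Ab A; [right|left].
  apply/setP=> e; rewrite /R /Fb eA !inE.
  case: (boolP (e \in A)) => //= eA'; case: (boolP (fx e)) => //= fe.
  by rewrite (kF e eA' fe) orbT.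
apply: leq_ltn_trans (leR b c) _.
have : #|[set e in A | row b e && (fx e || (k e != c))]| <= #|Ab|.
  by apply/subset_leq_card/subsetP => e; rewrite !inE => /and3P[-> ->].
have : #|Ab| < #|A|.
  rewrite proper_card // properEneq nA /=.
  by apply/subsetP=> e; rewrite inE => /andP[].
by lia.
Qed.

(** * Extending the coloring down a rooted prism *)

(* Edges of the prism over a tree rooted at [r] are encoded as pairs: [(None, u)]
   is the edge between the copies of [u], and [(Some b, u)] is the copy in layer
   [b] of the edge from [u] to [par u], meaningless for [u = r]. A tree edge is
   thus named by its lower end. *)
Section RootedPrism.

Variables (T L C : finType) (r : T) (par : T -> T) (dep : T -> nat) (d : nat).
Hypothesis depE : forall u, u != r -> dep u = (dep (par u)).+1.

Definition incident_edges (x : T) : {set T} :=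
  [set u | (u != r) && ((u == x) || (par u == x))].

Definition meets (x : T) (b : L) (e : option L * T) : bool :=
  (e == (None, x)) || (e.1 == Some b) && (e.2 \in incident_edges x).

(** A tree edge lies in the stars of both its ends; it is owned by the upper one, which is processed
    first. *)
Definition owner (e : option L * T) : T := if e.1 is Some _ then par e.2 else e.2.

Definition in_layer (b : L) (e : option L * T) : bool :=
  if e.1 is Some b' then b' == b else true.

Definition descendants (x : T) : {set T} :=
  [set u | (dep x <= dep u) && (iter (dep u - dep x) par u == x)].

Variables (pc : option L * T -> option C) (c0 : C).

Definition colored_codes : {set option L * T} := [set e | pc e != None].
Local Notation P := colored_codes.

Definition weight (x : T) : nat := #|[set e in P | owner e \in descendants x]|.
Definition own_weight (x : T) : nat := #|[set e in P | owner e == x]|.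
Definition code_color (e : option L * T) : C := odflt c0 (pc e).

Hypothesis pcr : forall b, pc (Some b, r) = None.
Hypothesis pc_proper : forall x b e e',
  meets x b e -> meets x b e' -> e != e' -> e \in P -> pc e != pc e'.
Hypothesis deg_le : forall x, #|incident_edges x| <= d.
Hypothesis cardC : #|C| = d.+1.
Hypothesis cardL : #|L| <= 2.
Hypothesis cardP : #|P| <= d.
(** This and [root_max] retain what is used of the choice of the root. In [root_max] both edges meet
    copies of [z], so it holds when [r] meets at least as many precolored edges as [z]. *)
Hypothesis root_hit : 0 < d -> 0 < own_weight r.
Hypothesis root_max : forall b z b' w, z != r -> w != r -> par z = r -> par w = z ->
  (Some b, z) \in P -> (Some b', w) \in P -> 1 < own_weight r.

Lemma par_neq z : z != r -> (par z == z) = false.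
Proof. by move=> zr; apply/negP => /eqP e; have := depE zr; rewrite e; lia. Qed.

Lemma descendants_refl x : x \in descendants x.
Proof. by rewrite inE leqnn subnn eqxx. Qed.

Lemma descendants_child x z u :
  z != r -> par z = x -> u \in descendants z -> (u \in descendants x) && (u != x).
Proof.
move=> zr zx; have dz := depE zr; rewrite !inE => /andP[le /eqP it].
rewrite zx in dz; have -> : dep u - dep x = (dep u - dep z).+1 by lia.
rewrite iterS it zx eqxx andbT; apply/andP; split; first by lia.
by apply/eqP => ux; move: le; rewrite ux dz; lia.
Qed.

Lemma descendants_inj x z w u : z != r -> par z = x -> w != r -> par w = x ->
  u \in descendants z -> u \in descendants w -> z = w.
Proof.
move=> zr zx wr wx; have := depE zr; have := depE wr; rewrite zx wx => dw dz.
by rewrite !inE dz dw => /andP[_ /eqP<-] /andP[_ /eqP<-].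
Qed.

Lemma weight_child x z : z != r -> par z = x -> own_weight x + weight z <= weight x.
Proof.
move=> zr zx; rewrite -cardsUI [X in _ + X](_ : _ = 0) ?addn0.
  apply/subset_leq_card/subsetP => e; rewrite !inE -andb_orr => /andP[-> /=].
  case/orP => [/eqP->|]; first by have := descendants_refl x; rewrite inE.
  move=> h; have := @descendants_child x z (owner e) zr zx.
  by rewrite !inE h => /(_ isT)/andP[].
apply/eqP; rewrite cards_eq0; apply/eqP/setP => e; rewrite in_set0; apply/negP.
case/setIP=> /setIdP[_ /eqP ex] /setIdP[_ /(descendants_child zr zx)].
by rewrite ex eqxx andbF.
Qed.

Lemma weight_children x z w : z != r -> par z = x -> w != r -> par w = x -> z != w ->
  own_weight x + weight z + weight w <= weight x.
Proof.
move=> zr zx wr wx zw.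
rewrite -[own_weight x + _]cardsUI [X in (_ + X) + _](_ : _ = 0) ?addn0; last first.
  apply/eqP; rewrite cards_eq0; apply/eqP/setP => e; rewrite in_set0; apply/negP.
  case/setIP=> /setIdP[_ /eqP ex] /setIdP[_ /(descendants_child zr zx)].
  by rewrite ex eqxx andbF.
rewrite -cardsUI [X in _ + X](_ : _ = 0) ?addn0.
  apply/subset_leq_card/subsetP => e; rewrite 2!in_setU.
  case/orP=> [/orP[|]|] /setIdP[eP].
  - by move/eqP=> ex; rewrite inE eP ex descendants_refl.
  - by case/(descendants_child zr zx)/andP => ? _; rewrite inE eP.
  - by case/(descendants_child wr wx)/andP => ? _; rewrite inE eP.
apply/eqP; rewrite cards_eq0; apply/eqP/setP => e; rewrite in_set0; apply/negP.
case/setIP=> /setUP[|] /setIdP[_ h] /setIdP[_ ew].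
- by have := descendants_child wr wx ew; rewrite (eqP h) eqxx andbF.
- by case/eqP: zw; apply: (descendants_inj zr zx wr wx h ew).
Qed.

(** The precolored edges constraining the tree edges from [x] to its children: those owned by [x]
    prescribe colors, those owned by a child forbid them. The vertical edge at [x] is passed to
    [star_completion] separately, as [v]. *)
Definition near_codes (x : T) : {set option L * T} :=
  [set e in P | (e != (None, x)) &&
    ((owner e == x) || (owner e != r) && (par (owner e) == x))].

Lemma near_codes_le x : #|near_codes x| + (pc (None, x) != None) <= weight x.
Proof.
have -> : (pc (None, x) != None) = ((None, x) \in [set e in P | owner e \in descendants x]).
  by rewrite inE descendants_refl andbT inE.
rewrite addnC /weight [X in _ <= X](cardsD1 (None, x)) leq_add2l.
apply/subset_leq_card/subsetP => e /setIdP[eP /andP[en ow]].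
rewrite in_setD1 en inE eP /=; case/orP: ow => [/eqP->|/andP[or /eqP ox]].
  exact: descendants_refl.
by have /andP[] := descendants_child or ox (descendants_refl _).
Qed.

Lemma code_colorE e : e \in P -> pc e = Some (code_color e).
Proof. by rewrite inE /code_color; case: (pc e). Qed.

Lemma code_color_neq x b e e' : meets x b e -> meets x b e' -> e != e' ->
  e \in P -> e' \in P -> code_color e != code_color e'.
Proof.
move=> me me' ne eP e'P; have := pc_proper me me' ne eP.
by rewrite !code_colorE //; apply: contra => /eqP->.
Qed.

Lemma colored_above e b : e \in P -> e.1 = Some b -> e.2 != r.
Proof.
case: e => o u; rewrite inE /= => + ob; apply: contra => /eqP ur.
by rewrite ob ur pcr.
Qed.

Lemma meets_owner x b e : e \in P -> owner e = x -> in_layer b e -> meets x b e.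
Proof.
move=> eP; have := @colored_above e; move: eP; case: e => [[b'|] u] eP ur.
  rewrite /owner /in_layer /meets /= => ux /eqP->.
  by rewrite inE ux !eqxx (ur b') ?orbT.
by rewrite /owner /= => ->; rewrite /meets eqxx.
Qed.

Lemma meets_top b z : z != r -> meets z b (Some b, z).
Proof. by move=> zr; rewrite /meets inE /= zr !eqxx. Qed.

(** The root has no edge above it, hence no color to respect. *)
Definition parent_colors (x : T) (ab : L -> C) : {set C} :=
  if x == r then set0 else [set ab b | b : L].

(* Suffices for the colouring [ab] of the two copies of the edge above [x] to
   extend to everything below [x]. *)
Definition extendable (x : T) (ab : L -> C) : Prop :=
  weight x + #|parent_colors x ab| <= d /\
  forall b e, x != r -> e \in P -> owner e = x -> in_layer b e ->
    ab b != code_color e.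

Definition star_colored (x : T) (c : C) (g : L -> T -> C) : Prop :=
  [/\ forall b, {in incident_edges x &, injective (g b)},
      forall b, {in incident_edges x, forall u, g b u != c}
    & forall e, e \in P -> owner e = x ->
      (if e.1 is Some b then g b e.2 else c) = code_color e].

Definition star_extends (x : T) (ab : L -> C) (c : C) (g : L -> T -> C) : Prop :=
  [/\ x != r -> forall b, g b x = ab b, star_colored x c g
    & forall z, z != r -> par z = x -> extendable z (g^~ z)].

(** Apply [star_completion] to the near codes together with the colors from above; [extendable] at
    [x] supplies the count of items. A child receives at most two colors, so the bound on weights
    makes every child extendable. *)
Lemma star_step_light x ab : extendable x ab ->
  (forall z, z != r -> par z = x -> weight z + 2 <= d) ->
  exists c g, star_extends x ab c g.
Proof.
move=> [wx compat] light.
(* Items are precolored edges ([inl]) or colors imposed from above ([inr]), the latter prescribed at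
   position [x]. A color used above [x] in both layers is one item lying in both rows, which is why
   only distinct colors are counted. *)
pose A : {set (option L * T) + C} :=
  (inl @: near_codes x) :|: (inr @: parent_colors x ab).
pose fx (i : (option L * T) + C) := if i is inl e then owner e == x else true.
pose row b (i : (option L * T) + C) :=
  match i with inl e => in_layer b e | inr t => ab b == t end.
pose pos (i : (option L * T) + C) :=
  match i with inl e => if owner e == x then e.2 else owner e | inr _ => x end.
pose k (i : (option L * T) + C) := match i with inl e => code_color e | inr t => t end.
have A1 e : inl e \in A -> e \in near_codes x.
  by case/setUP => /imsetP[e' e'P] //; case=> ->.
have A2 t : inr t \in A -> x != r /\ exists b, t = ab b.
  case/setUP => /imsetP[e' e'P] // [->]; move: e'P; rewrite /parent_colors.
  case: eqP => [_|_]; first by rewrite in_set0.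
  by case/imsetP=> b _ ->; split=> //; exists b.
have N e : e \in near_codes x -> owner e = x -> exists b u,
    [/\ e = (Some b, u), u != r & par u = x].
  case/setIdP=> eP /andP[en _] ox; have := @colored_above e.
  case: e eP en ox => [[b|] u] eP en ox; last first.
    by move: en; rewrite -ox /owner /= eqxx.
  by move/(_ b eP erefl); exists b, u; split.
have NP e : e \in near_codes x -> e \in P by case/setIdP.
have [|||||c [g [cv gP]]] := @star_completion L _ T C (incident_edges x) A fx row pos k
    (pc (None, x)) d (deg_le x) cardC.
- have := near_codes_le x; have : #|A| <= #|near_codes x| + #|parent_colors x ab|.
    by apply: (leq_trans (leq_card_setU _ _)); rewrite leq_add ?leq_imset_card.
  by lia.
- move=> [e /A1 eN|t /A2[xr _]]; last by rewrite inE /= xr eqxx.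
  rewrite /=; case: eqP => [ox|/eqP nx].
    by have [b [u [-> ur pu]]] := N e eN ox; rewrite inE /= ur pu eqxx orbT.
  case/setIdP: eN => _ /andP[_]; rewrite (negbTE nx) /= => /andP[or /eqP po].
  by rewrite inE or po eqxx orbT.
- move=> b [e|t] [e'|t'] eA e'A /= fe fe' re re'.
  + have eN := A1 _ eA; have e'N := A1 _ e'A; rewrite fe fe'.
    case=> h; congr inl.
      have [b1 [u1 [E1 _ _]]] := N _ eN (eqP fe); have [b2 [u2 [E2 _ _]]] := N _ e'N (eqP fe').
      by move: re re' h; rewrite E1 E2 /in_layer /= => /eqP-> /eqP-> ->.
    apply/eqP/negPn/negP => ne.
    have := code_color_neq (meets_owner (NP _ eN) (eqP fe) re)
      (meets_owner (NP _ e'N) (eqP fe') re') ne (NP _ eN) (NP _ e'N).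
    by rewrite h eqxx.
  + have eN := A1 _ eA; have [xr _] := A2 _ e'A; rewrite fe; case=> h.
      have [b1 [u1 [E1 ur pu]]] := N _ eN (eqP fe).
      by move: h (par_neq ur); rewrite E1 /= pu => ->; rewrite eqxx.
    have := compat b e xr (NP _ eN) (eqP fe) re.
    by rewrite (eqP re') h eqxx.
  + have eN := A1 _ e'A; have [xr _] := A2 _ eA; rewrite fe'; case=> h.
      have [b1 [u1 [E1 ur pu]]] := N _ eN (eqP fe').
      by move: h (par_neq ur); rewrite E1 /= pu => ->; rewrite eqxx.
    have := compat b e' xr (NP _ eN) (eqP fe') re'.
    by rewrite (eqP re) h eqxx.
  + by rewrite -(eqP re) -(eqP re').
- move=> b [e|t] [e'|t'] eA e'A //= fe fe' re re'; rewrite (negbTE fe').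
    have eN := A1 _ eA; have e'N := A1 _ e'A; rewrite fe => h.
    have [b1 [u1 [E1 ur pu]]] := N _ eN (eqP fe).
    have bb : b1 = b by move: re; rewrite E1 => /eqP.
    have E : e = (Some b, u1) by rewrite E1 bb.
    have o' : owner e' = u1 by rewrite -h E.
    apply: (@code_color_neq u1 b); rewrite ?NP //.
    + by rewrite E meets_top.
    + exact: meets_owner (NP _ e'N) o' re'.
    + by apply: contraNneq fe' => <-.
  move=> h; move: fe'; have e'N := A1 _ e'A.
  by case/setIdP: e'N => _ /andP[_]; rewrite -h eqxx.
- move=> [e|t] eA /= fe.
    have eN := A1 _ eA; have [b [u [E ur pu]]] := N _ eN (eqP fe).
    rewrite -code_colorE ?NP //.
    apply: (@pc_proper x b); rewrite ?NP //.
    + by apply: meets_owner (NP _ eN) (eqP fe) _; rewrite E /in_layer /= eqxx.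
    + by rewrite /meets eqxx.
    + by rewrite E.
  have [xr [b ->]] := A2 _ eA.
  have [pn|pn] := eqVneq (pc (None, x)) None; first by rewrite pn.
  have nP : (None, x) \in P by rewrite inE.
  rewrite (code_colorE nP); have := compat b (None, x) xr nP erefl isT.
  by apply: contra => /eqP[->].
have gA b e : e \in near_codes x -> in_layer b e ->
    (g b (pos (inl e)) == code_color e) = (owner e == x).
  move=> eN re; have [_ _ /(_ (inl e))] := gP b; apply=> //.
  by rewrite inE imset_f.
exists c, g; split.
- move=> xr b; have [_ _ /(_ (inr (ab b)))] := gP b; rewrite /= eqxx.
  have -> : inr (ab b) \in A.
    by rewrite inE; apply/orP; right; rewrite imset_f // /parent_colors (negbTE xr) imset_f.
  by move=> /(_ isT isT)/eqP.
- split=> [b|b|e eP ox]; try by have [] := gP b.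
  have [e0|en] := eqVneq e (None, x).
    have pn : pc (None, x) != None by move: eP; rewrite e0 inE.
    by rewrite e0 /code_color (cv pn).
  have eN : e \in near_codes x by rewrite inE eP en ox eqxx.
  have [b [u [E ur pu]]] := N _ eN ox.
  by have := gA b e eN; rewrite /= ox eqxx E /in_layer /= eqxx => /(_ isT)/eqP.
- move=> z zr zx; split=> [|b e _ eP oz re].
    have : #|parent_colors z (g^~ z)| <= #|L|.
      by rewrite /parent_colors (negbTE zr) leq_imset_card.
    by have := light z zr zx; lia.
  have zx' : (z == x) = false by rewrite -zx eq_sym par_neq.
  have eN : e \in near_codes x.
    rewrite inE eP oz zr zx eqxx orbT andbT.
    by apply: contraFneq zx' => e0; rewrite -oz e0.
  by have := gA b e eN re; rewrite /= oz zx' => ->.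
Qed.

(* All the weight below [x] sits in the branch of [z], so that, apart from one
   prescribed colour, the only constraint is on the edge from [x] to [z]; then
   both layers can be coloured alike. *)
Lemma star_step_heavy x z (u : option T) (p : C) ab :
  z != r -> par z = x -> d <= weight z + 1 -> weight z < d ->
  (forall w, w != r -> par w = x -> w != z -> weight w = 0) ->
  u \in None |: Some @: incident_edges x ->
  (x != r -> u = Some x /\ forall b, ab b = p) ->
  (forall e, e \in P -> owner e = x ->
     (if e.1 is Some _ then Some e.2 else None) = u /\ code_color e = p) ->
  (u = Some z -> forall e, e \in P -> owner e = z -> code_color e != p) ->
  exists c g, star_extends x ab c g.
Proof.
move=> zr zx heavy ltz light uZ parent own_x uz.
(* Slot [None] is the vertical edge, [Some w] a tree edge, and [u] is the slot colored [p]. The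
   color [t] of slot [Some z] must avoid [F]. If [u] is that slot, [t = p] works by [uz]; if not,
   [p] and [F] together miss one of the [d + 1] colors. *)
pose F := code_color @: [set e in P | owner e == z].
have leF : #|F| < d.
  apply: leq_ltn_trans ltz; apply: (leq_trans (leq_imset_card _ _)).
  apply/subset_leq_card/subsetP=> e /setIdP[eP /eqP ez].
  by rewrite inE eP ez descendants_refl.
have [t [tF tp]] : exists t, t \notin F /\ ((u = Some z) <-> (t = p)).
  have [e|ne] := eqVneq u (Some z).
    exists p; split=> //; apply/negP => /imsetP[e' /setIdP[eP /eqP ez] pe].
    by have := uz e e' eP ez; rewrite pe eqxx.
  have [t] : exists t, t \in ~: (p |: F).
    apply/set0Pn; rewrite -card_gt0; have := cardsC (p |: F).
    by rewrite cardsU1 cardC; case: (p \notin F) => /=; lia.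
  rewrite !inE negb_or => /andP[tp tF]; exists t; split=> //.
  by split=> e; [rewrite e eqxx in ne | rewrite e eqxx in tp].
have zX : z \in incident_edges x by rewrite inE zr zx eqxx orbT.
(* There are at most [d + 1] slots, so a single injection colors the vertical edge and both
   layers. *)
pose Z : {set option T} := None |: Some @: incident_edges x.
have [||s1 s2|h hI hE] := @injection_extend (option T) C [set u; Some z] Z
    (fun s => if s == u then p else t).
- rewrite cardsU1 card_imset; last by move=> ? ? [].
  by have := deg_le x; rewrite cardC; case: (_ \notin _) => /=; lia.
- by rewrite subUset !sub1set uZ inE imset_f // orbT.
- rewrite !inE => /orP[]/eqP-> /orP[]/eqP->; rewrite ?eqxx //.
  + by case: eqP => [//|ne] e; case: ne; apply/esym/tp.
  + by case: eqP => [//|ne] e; case: ne; apply/esym/tp.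
have hu : h u = p by rewrite hE ?inE ?eqxx.
have hz : h (Some z) = t.
  by rewrite hE ?inE ?eqxx ?orbT //; case: eqP => // /esym/tp.
have XZ v : v \in incident_edges x -> Some v \in Z.
  by move=> vX; rewrite inE imset_f // orbT.
exists (h None), (fun _ v => h (Some v)); split.
- by move=> /parent[e abp] b; rewrite -e abp.
- split=> [_ v w vX wX /hI e|_ v vX|e eP /(own_x _ eP)].
  + by have [] := e (XZ _ vX) (XZ _ wX).
  + by apply/eqP => /hI e; have := e (XZ _ vX) (setU11 _ _).
  + by case: e eP => [[b|] v] _ /= [-> ->].
- move=> w wr wx; split=> [|b e _ eP ow _].
    (* Both layers agree, so a child receives a single color and weight at most [d - 1] suffices. *)
    have le1 : #|parent_colors w (fun=> h (Some w))| <= 1.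
      rewrite /parent_colors (negbTE wr) -(cards1 (h (Some w))).
      by apply/subset_leq_card/subsetP => _ /imsetP[b _ ->]; rewrite inE.
    apply: leq_trans (leq_add (leqnn _) le1) _.
    have [->|wz] := eqVneq w z; first by lia.
    by rewrite (light w wr wx wz); lia.
  have [wz|wz] := eqVneq w z.
    rewrite wz hz; apply/negP => /eqP te; case/negP: tF; rewrite te.
    by apply: imset_f; rewrite inE eP ow wz eqxx.
  have /eqP := light w wr wx wz; rewrite cards_eq0 => /eqP w0.
  by move: (in_set0 e); rewrite -w0 inE eP ow descendants_refl.
Qed.

(** A child of weight at least [d - 1] leaves room for one more unit at [x]. Away from the root it
    is taken by the color of the edge above [x], which is therefore the same in both layers; at the
    root, by the one precolored edge owned by [r]. *)
Lemma star_step x ab : L -> extendable x ab -> exists c g, star_extends x ab c g.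
Proof.
move=> b0 ext; have [wx compat] := ext.
have [/existsP[z /and3P[zr /eqP zx heavy]]|light] :=
    boolP [exists z, [&& z != r, par z == x & d <= weight z + 1]]; last first.
  apply: star_step_light => // z zr zx; move: light.
  by rewrite negb_exists => /forallP/(_ z); rewrite zr zx eqxx /=; lia.
have d_gt0 : 0 < d.
  apply: leq_trans (deg_le x); rewrite card_gt0; apply/set0Pn; exists z.
  by rewrite inE zr zx eqxx orbT.
have wz := weight_child zr zx.
have wzw w wr wx := @weight_children x z w zr zx wr wx.
have [xr|xr] := eqVneq x r; last first.
  have im_gt0 : 0 < #|parent_colors x ab|.
    rewrite /parent_colors (negbTE xr) card_gt0; apply/set0Pn; exists (ab b0).
    exact: imset_f.
  have own0 : own_weight x = 0 by lia.
  have noown e : e \in P -> owner e <> x.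
    move=> eP ex; move/eqP: own0; rewrite cards_eq0 => /eqP e0.
    by move: (in_set0 e); rewrite -e0 inE eP ex eqxx.
  have abc b : ab b = ab b0.
    have /cards1P[a im] : #|[set ab b | b : L]| == 1.
      by move: im_gt0 wx; rewrite /parent_colors (negbTE xr); lia.
    have ia b' : ab b' = a.
      by apply/set1P; rewrite -im; apply: imset_f.
    by rewrite !ia.
  apply: (@star_step_heavy x z (Some x) (ab b0)) => //.
  - by lia.
  - by move=> w wr wpx; rewrite eq_sym => /(wzw w wr wpx); lia.
  - by rewrite inE imset_f ?orbT // inE xr eqxx.
  - by move=> e /noown.
  - by move=> [xz]; move: (par_neq zr); rewrite zx xz eqxx.
have := root_hit d_gt0; rewrite -xr => own_gt0.
have own1 : own_weight x = 1.
  have : weight x <= #|P| by apply/subset_leq_card/subsetP => e /setIdP[].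
  by lia.
have /cards1P[e1 E1] : #|[set e in P | owner e == x]| == 1 by apply/eqP.
have /setIdP[e1P /eqP ow1] : e1 \in [set e in P | owner e == x] by rewrite E1 set11.
have only e : e \in P -> owner e = x -> e = e1.
  by move=> eP ex; apply/set1P; rewrite -E1 inE eP ex eqxx.
have wx' : weight x <= d.
  by apply: leq_trans cardP; apply/subset_leq_card/subsetP => e /setIdP[].
apply: (@star_step_heavy x z (if e1.1 is Some _ then Some e1.2 else None)
    (code_color e1)) => //.
- by lia.
- by move=> w wr wpx; rewrite eq_sym => /(wzw w wr wpx); lia.
- have := @colored_above e1; case: e1 e1P ow1 {E1 only} => [[b|] u] e1P ow1 /= ur.
    rewrite inE imset_f ?orbT // inE (ur b) //=.
    by move: ow1; rewrite /owner /= => ->; rewrite eqxx orbT.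
  exact: setU11.
- by rewrite xr eqxx.
- by move=> e eP ex; rewrite (only e eP ex).
(* If [e1] is a copy of the edge from [r] to [z], its color is repeated in the other layer, where an
   edge owned by [z] might already have it. By [root_max], such an edge would force [own_weight r]
   above 1. *)
case E: e1 => [[b|] u] //= [uz] e eP ez.
have ne : e != e1.
  apply/eqP => ee; have := par_neq zr; rewrite zx.
  by rewrite -ez -ow1 ee eqxx.
have [bb|bb] := boolP (in_layer b e).
  rewrite -E; apply: (@code_color_neq z b) => //.
  - exact: meets_owner.
  - by rewrite E uz meets_top.
case: e eP ez ne bb => [[b1|] w] // eP ez ne bb.
have := @root_max b z b1 w zr; rewrite (colored_above eP erefl) -xr own1 zx.
by rewrite -uz -E => /(_ isT erefl); move/(_ _ e1P eP); rewrite uz; move/(_ ez).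
Qed.

(** Stars at the same depth share no edge, so a whole level is solved at once. The first clause is
    the invariant at the frontier, the second records the finished stars. *)
Lemma level_coloring (b0 : L) k : exists col : option L * T -> C,
  (forall u, u != r -> dep u <= k -> extendable u (fun b => col (Some b, u))) /\
  (forall x, dep x < k ->
     star_colored x (col (None, x)) (fun b u => col (Some b, u))).
Proof.
elim: k => [|k [col [IH1 IH2]]].
  by exists (fun=> c0); split=> // u ur; rewrite depE.
have /fin_all_exists[sol solP] : forall x, exists s : C * (L -> T -> C), dep x = k ->
    star_extends x (fun b => col (Some b, x)) s.1 s.2.
  move=> x; have [dx|] := eqVneq (dep x) k; last first.
    by move=> /eqP nx; exists (c0, fun _ _ => c0).
  suff : extendable x (fun b => col (Some b, x)).
    by move=> /(star_step b0)[c [g ?]]; exists (c, g).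
  have [xr|xr] := eqVneq x r; last by apply: IH1; rewrite ?dx.
  split; last by rewrite xr eqxx.
  rewrite /parent_colors xr eqxx cards0 addn0; apply: leq_trans cardP.
  by apply/subset_leq_card/subsetP => e /setIdP[].
pose col' (e : option L * T) := match e.1 with
  | None => if dep e.2 == k then (sol e.2).1 else col e
  | Some b => if dep e.2 == k.+1 then (sol (par e.2)).2 b e.2 else col e end.
exists col'; split=> [u ur|x];
  [rewrite leq_eqVlt ltnS|rewrite ltnS leq_eqVlt] => /orP[/eqP du|lek].
- have := depE ur; rewrite du => -[dp].
  have [_ _ /(_ u ur erefl)] := solP (par u) (esym dp).
  by rewrite /extendable /parent_colors /col' /= du eqxx.
- have := IH1 u ur lek; rewrite /extendable /parent_colors /col' /=.
  by have -> : (dep u == k.+1) = false by lia.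
- have [top [gI gN gE] _] := solP x du; rewrite /col' /=.
  have X u b : u \in incident_edges x ->
      (if dep u == k.+1 then (sol (par u)).2 b u else col (Some b, u)) = (sol x).2 b u.
    rewrite inE => /andP[ur /orP[/eqP ux|/eqP pu]].
      by rewrite ux du (_ : (k == k.+1) = false) ?top -?ux //; lia.
    by rewrite depE // pu du eqxx.
  split=> [b u v uX vX|b u uX|e eP ow] /=; rewrite ?du ?eqxx.
  + by rewrite !X //; apply: gI.
  + by rewrite X // gN.
  + rewrite -gE //; have := @meets_owner x; have := @colored_above e.
    case: e eP ow => [[b|] u] eP ow //= ur _.
    by apply: X; rewrite inE (ur b) //=; move: ow; rewrite /owner /= => ->; rewrite eqxx orbT.
- have [gI gN gE] := IH2 x lek; rewrite /col' /=.
  have X u b : u \in incident_edges x ->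
      (if dep u == k.+1 then (sol (par u)).2 b u else col (Some b, u)) = col (Some b, u).
    rewrite inE => /andP[ur /orP[/eqP ux|/eqP pu]].
      by rewrite ux (_ : (dep x == k.+1) = false) //; lia.
    by rewrite depE // pu (_ : (_.+1 == k.+1) = false) //; lia.
  have xk : (dep x == k) = false by lia.
  split=> [b u v uX vX|b u uX|e eP ow] /=; rewrite ?xk.
  + by rewrite !X //; apply: gI.
  + by rewrite X // gN.
  + rewrite -gE //; have := @colored_above e.
    case: e eP ow => [[b|] u] eP ow //= ur.
    by apply: X; rewrite inE (ur b) //=; move: ow; rewrite /owner /= => ->; rewrite eqxx orbT.
Qed.

Lemma rooted_prism_coloring : L -> exists col : option L * T -> C,
  (forall x b e e', meets x b e -> meets x b e' -> e != e' -> col e != col e') /\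
  (forall e c, pc e = Some c -> col e = c).
Proof.
(* With [k] above all depths, every star is finished. *)
move=> b0; have [col [_ colP]] := level_coloring b0 (\max_(x : T) dep x).+1.
have {colP} star x : star_colored x (col (None, x)) (fun b u => col (Some b, u)).
  by apply: colP; rewrite ltnS leq_bigmax.
exists col; split=> [x b [o u] [o' u']|e c ec].
  have [gI gN _] := star x; rewrite /meets /=.
  case/orP=> [/eqP[-> ->]|/andP[/eqP-> uX]]; case/orP=> [/eqP[-> ->]|/andP[/eqP-> u'X]].
  - by rewrite eqxx.
  - by move=> _; rewrite eq_sym gN.
  - by rewrite gN.
  - by apply: contra => /eqP/gI->.
have eP : e \in P by rewrite inE ec.
have [_ _ /(_ e eP erefl)] := star (owner e).
by rewrite /code_color ec /= => <-; case: e {ec eP} => [[b|] u].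
Qed.

End RootedPrism.

(** * Rooting a tree *)

(** A subtree containing [r] is grown vertex by vertex: connectedness gives an edge leaving it, and
    acyclicity makes the inner end of that edge the only neighbor of the new vertex inside, hence
    its parent. *)
Lemma tree_rooting (T : sgraph) (r : T) : is_tree T ->
  exists (par : T -> T) (dep : T -> nat),
    (forall u, u != r -> dep u = (dep (par u)).+1) /\
    (forall u v, sedge u v = (u != r) && (par u == v) || (v != r) && (par v == u)).
Proof.
case=> -[_ conn] acyc.
pose inside (D : {set T}) u v := [&& sedge u v, u \in D & v \in D].
have step n : n < #|T| -> exists (D : {set T}) (par : T -> T) (dep : T -> nat),
   [/\ #|D| = n.+1, r \in D, {in D, forall u, connect (inside D) r u},
    {in D, forall u, u != r -> (par u \in D) /\ dep u = (dep (par u)).+1}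
   & {in D &, forall u v,
       sedge u v = (u != r) && (par u == v) || (v != r) && (par v == u)}].
  elim: n => [_|n IHn ltn].
    exists [set r], id, (fun=> 0); split; rewrite ?cards1 ?set11 //.
    - by move=> u /set1P->; apply: connect0.
    - by move=> u /set1P->; rewrite eqxx.
    - by move=> u v /set1P-> /set1P->; rewrite sg_irrefl eqxx.
  have [D [par [dep [cD rD cn pD eD]]]] := IHn (ltnW ltn).
  have [x [y [xD yD xy]]] : exists x y, [/\ x \in D, y \notin D & sedge x y].
    have [y0 y0D] : exists y0, y0 \notin D.
      apply/existsP; apply: contraLR ltn => /existsPn allD.
      rewrite -leqNgt -cD; apply/subset_leq_card/subsetP => y0 _.
      by have := allD y0; rewrite negbK.
    apply/'exists_'exists_and3P; apply: contraR y0D => none.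
    rewrite -(closed_connect _ (conn r y0)) // => x y xy.
    apply/idP/idP => h; apply: contraR none => h'; apply/'exists_'exists_and3P.
      by exists x, y.
    by exists y, x; rewrite sg_sym.
  (* A second neighbor [x'] would be joined to [x] by a simple path inside [D], which [y] closes to
     a cycle of length at least 3. *)
  have uniq_nb x' : x' \in D -> sedge x' y -> x' = x.
    move=> x'D x'y; apply/eqP/negPn/negP => ne.
    have : connect (inside D) x x'.
      apply: (connect_trans _ (cn _ x'D)).
      rewrite (@sym_connect_sym _ (inside D)) ?cn // => u v.
      by rewrite /inside sg_sym; case: (sedge v u) => //=; rewrite andbC.
    case/connectP=> p pp; case: (shortenP pp) => q pq uq _ lq.
    have qD : all (mem D) q.
      elim: (q) (x) pq => //= z q' IH x1 /andP[/and3P[_ _ zD] /IH->].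
      by rewrite /= zD.
    have := acyc (y :: x :: q); rewrite ltnS ltnS ltnS.
    case: q pq uq lq qD => [_ _ e|z q pq uq lq qD] /=; first by rewrite e eqxx in ne.
    suff: ucycle (@sedge T) [:: y, x, z & q] by move=> h /(_ h).
    apply/andP; split.
      change (sedge y x && path (@sedge T) x (rcons (z :: q) y)).
      rewrite rcons_path -lq x'y sg_sym xy andbT.
      by apply: sub_path pq => u v /and3P[].
    rewrite cons_uniq uq andbT; apply/negP; rewrite inE.
    case/orP=> [/eqP yx|/(allP qD) h]; first by rewrite yx xD in yD.
    by case/negP: yD; exact: h.
  pose par' u := if u == y then x else par u.
  pose dep' u := if u == y then (dep x).+1 else dep u.
  have neq u : u \in D -> (u == y) = false by move=> uD; apply: contraNF yD => /eqP<-.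
  have par'D u : u \in D -> par' u = par u by move=> uD; rewrite /par' neq.
  have dep'D u : u \in D -> dep' u = dep u by move=> uD; rewrite /dep' neq.
  have par'y : par' y = x by rewrite /par' eqxx.
  have dep'y : dep' y = (dep x).+1 by rewrite /dep' eqxx.
  have yr : y != r by rewrite eq_sym neq.
  have sub : subrel (connect (inside D)) (connect (inside (y |: D))).
    by apply: connect_sub => u v /and3P[uv uD vD]; apply: connect1;
       rewrite /inside uv !inE uD vD !orbT.
  have Dy u : u \in D -> sedge u y = (x == u).
    move=> uD; apply/idP/eqP => [/(uniq_nb u uD)->//|<-//].
  exists (y |: D), par', dep'; split.
  - by rewrite cardsU1 yD cD.
  - by rewrite inE rD orbT.
  - move=> u /setU1P[->|uD]; last exact: sub (cn u uD).
    apply: connect_trans (sub _ _ (cn x xD)) (connect1 _).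
    by rewrite /inside xy !inE eqxx xD orbT.
  - move=> u /setU1P[->|uD] ur; first by rewrite par'y inE xD orbT dep'y dep'D.
    have [pu du] := pD u uD ur.
    by rewrite par'D // inE pu orbT !dep'D.
  - move=> u v /setU1P[->|uD] /setU1P[->|vD].
    + by rewrite sg_irrefl par'y yr /= (neq x xD).
    + rewrite sg_sym Dy // par'y yr par'D //= orbC.
      have [->|vr] := eqVneq v r => //=.
      by rewrite (neq _ (proj1 (pD v vD vr))).
    + rewrite Dy // par'y yr par'D //=.
      have [->|ur] := eqVneq u r => //=.
      by rewrite (neq _ (proj1 (pD u uD ur))).
    + by rewrite !par'D // eD.
have T0 : 0 < #|T| by apply/card_gt0P; exists r.
have [|D [par [dep [cD rD _ pD eD]]]] := step #|T|.-1; first by rewrite prednK.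
have DT u : u \in D.
  have /eqP-> : D == setT by rewrite eqEcard subsetT cardsT cD prednK ?leqnn.
  by rewrite inE.
exists par, dep; split=> [u ur|u v]; last exact: eD.
by have [] := pD u (DT u) ur.
Qed.

(** * Coding the edges of the prism *)

Section PrismCodes.

Variables (T : sgraph) (r : T) (par : T -> T) (dep : T -> nat).
Hypothesis depE : forall u, u != r -> dep u = (dep (par u)).+1.
Hypothesis edgeE : forall u v : T,
  sedge u v = (u != r) && (par u == v) || (v != r) && (par v == u).

Definition code_edge (e : option 'I_2 * T) : {set T □ 'K_2} :=
  match e.1 with
  | None => [set (e.2, ord0); (e.2, ord_max)]
  | Some b => [set (e.2, b); (par e.2, b)]
  end.

Definition valid_code (e : option 'I_2 * T) : bool := (e.1 == None) || (e.2 != r).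

Lemma ord2P (b : 'I_2) : b = ord0 \/ b = ord_max.
Proof. by case: b => [[|[|]]] // ?; [left | right]; apply: val_inj. Qed.

Lemma meets_valid x (b : 'I_2) e : meets r par x b e -> valid_code e.
Proof.
case/orP=> [/eqP->//|/andP[_]]; rewrite inE => /andP[ur _].
by rewrite /valid_code ur orbT.
Qed.

Lemma mem_code_edge x b e : valid_code e -> ((x, b) \in code_edge e) = meets r par x b e.
Proof.
case: e => [[b'|] u]; rewrite /valid_code /code_edge /meets /= => ur.
  rewrite !inE /= ur !xpair_eqE /= (inj_eq Some_inj) (eq_sym b') (eq_sym u) (eq_sym (par u)).
  by case: (x == u); case: (x == par u); case: (b == b').
rewrite !inE !xpair_eqE orbF (eq_sym u) /=.
by case: (ord2P b) => ->; rewrite ?eqxx ?andbT ?andbF ?orbT ?orbF.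
Qed.

(** An edge is determined by the vertices it contains, which [meets] reads off the code. Two names
    for one tree edge would make each end the parent of the other, against the depths. *)
Lemma code_edge_inj : {in valid_code &, injective code_edge}.
Proof.
move=> [o u] [o' u'] v v' E.
have M x b : meets r par x b (o, u) = meets r par x b (o', u').
  by rewrite -!mem_code_edge // E.
have up a (b : 'I_2) : valid_code (Some b, a) -> meets r par a b (Some b, a).
  by rewrite /valid_code /= => ar; rewrite /meets /= inE ar !eqxx.
have nn a (b : 'I_2) : meets r par a b (None, a) by rewrite /meets eqxx.
case: o o' v v' M {E} => [b|] [b'|] v v' M.
- have := M u b; have := M u' b'; rewrite !up //.
  rewrite /meets /= !inE => /andP[/eqP[bb] /andP[ur e1]] /esym/andP[_ /andP[ur' e2]].
  subst b'.
  case/orP: e1 => [/eqP->//|/eqP p1]; case/orP: e2 => [/eqP->//|/eqP p2].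
  by have := depE ur; have := depE ur'; rewrite p1 p2; lia.
- have := M u' ord0; have := M u' ord_max; rewrite !nn /meets /=.
  by move=> /andP[/eqP[->] _] /andP[].
- have := M u ord0; have := M u ord_max; rewrite !nn /meets /=.
  by move=> /esym/andP[/eqP[->] _] /esym/andP[].
- have := M u ord0; rewrite nn /meets /= orbF => /esym/eqP[->] //.
Qed.

Lemma code_edge_edges e : valid_code e -> code_edge e \in edges (T □ 'K_2).
Proof.
case: e => [[b|] u]; rewrite /valid_code /code_edge /= => ur.
  apply/imsetP; exists ((u, b), (par u, b)) => //.
  by rewrite inE /= /cartesian_rel /= edgeE ur !eqxx orbT.
apply/imsetP; exists ((u, ord0), (u, ord_max)) => //.
by rewrite inE /= /cartesian_rel /= eqxx.
Qed.

Lemma code_edge_surj s : s \in edges (T □ 'K_2) ->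
  exists2 e, valid_code e & code_edge e = s.
Proof.
case/imsetP=> -[[u b] [v b']]; rewrite inE /= /cartesian_rel /= => + ->.
case/orP=> /andP[].
  move=> /eqP<- bb; exists (None, u) => //; rewrite /code_edge /=.
  move: bb; case: (ord2P b) => ->; case: (ord2P b') => -> //=.
  by rewrite setUC.
rewrite edgeE => /orP[]/andP[ur /eqP<-] /eqP->.
  by exists (Some b', u); rewrite /valid_code ?ur.
by exists (Some b', v); rewrite /valid_code ?ur // /code_edge /= setUC.
Qed.

(** Each incident edge is sent to its other end; this is injective because, by depth, no child of
    [x] is also its parent. *)
Lemma incident_edges_degree x :
  #|incident_edges r par x| <= #|[set y | sedge x y]|.
Proof.
pose f u := if u == x then par x else u.
have fI : {in incident_edges r par x &, injective f}.
  have no u : u != r -> par u = x -> x != r -> u <> par x.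
    move=> ur ux xr up; have := depE ur; have := depE xr.
    by rewrite -up ux; lia.
  move=> u v; rewrite !inE => /andP[+ +] /andP[+ +]; rewrite /f.
  have [->|_] := eqVneq u x; have [->|_] //= := eqVneq v x.
    by move=> xr _ vr /eqP vp e; case: (no v vr vp xr (esym e)).
  by move=> ur /eqP up xr _ e; case: (no u ur up xr e).
rewrite -(card_in_imset fI); apply/subset_leq_card/subsetP => _ /imsetP[u + ->].
rewrite !inE edgeE /f => /andP[ur].
have [<-|ux] /= := eqVneq u x; first by rewrite ur eqxx.
by move=> ->; rewrite ur orbT.
Qed.

End PrismCodes.

(** * Transfer from codes to precolorings of [T □ 'K_2] *)

Theorem theorem2p3 (T : sgraph)
    (phi : edge (T □ 'K_2) -> option 'I_(max_degree T).+1) :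
  is_tree T ->
  edge_precoloring phi ->
  #|precolored phi| = max_degree T ->
  exists f : edge (T □ 'K_2) -> 'I_(max_degree T).+1,
    proper_edge_coloring f /\ extends f phi.
Proof.
move=> tree proper_phi card_phi.
have /card_gt0P[x0 _] : 0 < #|T| by case: tree => -[].
pose load (x : T) := #|[set s in precolored phi | [exists b, (x, b) \in val s]]|.
have [r rmax] : exists r, forall x, load x <= load r.
  by case: (@arg_maxnP T x0 xpredT load isT) => r _ h; exists r => x; apply: h.
have [par [dep [depE edgeE]]] := tree_rooting r tree.
pose E := code_edge par; pose valid := valid_code r.
pose pc e := if valid e then obind phi (insub (E e)) else None.
have pcE (s : edge (T □ 'K_2)) e : valid e -> E e = val s -> pc e = phi s.
  by rewrite /pc => -> ->; rewrite valK.
pose P := colored_codes pc.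
have P_valid e : e \in P -> valid e by rewrite inE /pc; case: (valid e).
have edge_of e : valid e -> exists s : edge (T □ 'K_2), E e = val s.
  by move=> /(code_edge_edges edgeE) h; exists (exist (fun s => s \in edges (T □ 'K_2)) _ h).
have /fin_all_exists[code codeP] : forall s : edge (T □ 'K_2), exists e,
    valid e /\ E e = val s.
  by move=> s; have [e ? ?] := code_edge_surj edgeE (valP s); exists e.
have codeK (s : edge (T □ 'K_2)) e : valid e -> E e = val s -> code s = e.
  have [vc cE] := codeP s; move=> ve ee; apply: (code_edge_inj depE) => //.
  by rewrite -/E cE.
have code_inj : injective code.
  by move=> s s' e; apply: val_inj; rewrite -(codeP s).2 -(codeP s').2 e.
have codeEP s : (code s \in P) = (s \in precolored phi).
  by rewrite !inE (pcE s) //; case: (codeP s).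
have codeM (s : edge (T □ 'K_2)) x b : ((x, b) \in val s) = meets r par x b (code s).
  by have [vc cE] := codeP s; rewrite -cE (mem_code_edge _ _ _ vc).
have code_ex e : valid e -> exists s, code s = e.
  by move=> ve; have [s es] := edge_of e ve; exists s; apply: codeK.
have meets_ow (e : option 'I_2 * T) x b : meets r par x b e -> x = r -> owner par e = r.
  case: e => o u /orP[/eqP[-> ->]//|/andP[/eqP/= -> +]] xr.
  by rewrite inE xr /owner /= => /andP[/negbTE-> /eqP].
have adj x b (s s' : edge (T □ 'K_2)) : meets r par x b (code s) -> meets r par x b (code s') ->
    s != s' -> adjacent_edges s s'.
  rewrite -!codeM => xs xs' ne; rewrite /adjacent_edges ne /=.
  by apply/set0Pn; exists (x, b); rewrite inE xs.
(* Nothing lies above the root, so every edge meeting one of its copies is owned by it. *)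
have load_own : load r <= own_weight par pc r.
  rewrite /load -(card_imset _ code_inj); apply/subset_leq_card/subsetP => _ /imsetP[s + ->].
  case/setIdP=> sP /existsP[b]; rewrite codeM => m.
  by rewrite inE codeEP sP (meets_ow _ _ _ m) ?eqxx.
have [||||||||col [col_proper col_ext]] := @rooted_prism_coloring T 'I_2
    'I_(max_degree T).+1 r par dep (max_degree T) depE pc ord0 _ _ _ _ _ _ _ _ ord0.
- by move=> b; rewrite /pc /valid /valid_code /= eqxx.
- move=> x b e e' m m' ne eP.
  have [s es] := code_ex e (meets_valid m); have [s' es'] := code_ex e' (meets_valid m').
  have [vs Es] := codeP s; have [vs' Es'] := codeP s'.
  move: m m' ne eP; rewrite -es -es' => m m' ne.
  rewrite (pcE s) // (pcE s') // codeEP => sP.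
  have [s'P|] := boolP (s' \in precolored phi).
    by apply: proper_phi sP s'P _; apply: adj m m' _; apply: contraNneq ne => ->.
  by rewrite inE negbK => /eqP->; move: sP; rewrite inE.
- move=> x; apply: leq_trans (incident_edges_degree depE edgeE x) _.
  exact: (@leq_bigmax T (fun x => #|[set y | sedge x y]|)).
- by rewrite card_ord.
- by rewrite card_ord.
- apply: (@leq_trans #|precolored phi|); last by rewrite card_phi.
  rewrite -(card_imset _ code_inj); apply/subset_leq_card/subsetP => e eP.
  have [s es] := code_ex e (P_valid e eP).
  by rewrite -es imset_f // -codeEP es.
- move=> d_gt0; apply: leq_trans load_own.
  have /set0Pn[s sP] : precolored phi != set0 by rewrite -card_gt0 card_phi.
  have [vs _] := codeP s.
  have [b m] : exists b, meets r par (code s).2 b (code s).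
    case: (code s) vs => [[b|] u]; rewrite /valid /valid_code /meets /= => vs.
      by exists b; rewrite inE vs !eqxx.
    by exists ord0; rewrite eqxx.
  apply: leq_trans (rmax (code s).2); rewrite card_gt0; apply/set0Pn; exists s.
  by rewrite inE sP; apply/existsP; exists b; rewrite codeM.
(* Both edges meet copies of [z], so the load of [z], and with it that of [r], is at least 2. *)
- move=> b z b' w zr wr pz pw e1P e2P; apply: leq_trans load_own.
  have [s es] := code_ex _ (P_valid _ e1P); have [s' es'] := code_ex _ (P_valid _ e2P).
  apply: leq_trans (rmax z).
  have ne : s != s'.
    apply/eqP => ss; have := depE w wr; rewrite pw.
    by move: es'; rewrite -ss es => -[_ ->]; lia.
  have <- : #|[set s; s']| = 2 by rewrite cards2 ne.
  apply/subset_leq_card/subsetP => t /set2P[]->.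
    rewrite inE -codeEP es e1P; apply/existsP; exists b.
    by rewrite codeM es /meets /= inE zr !eqxx.
  rewrite inE -codeEP es' e2P; apply/existsP; exists b'.
  by rewrite codeM es' /meets /= inE wr pw !eqxx orbT.
exists (fun s => col (code s)); split=> [s s' /andP[ne /set0Pn[[x b] /setIP[]]]|s c sc].
  rewrite !codeM => m m'; apply: col_proper m m' _.
  by apply: contra ne => /eqP/code_inj->.
by apply: col_ext; rewrite (pcE s) //; case: (codeP s).
Qed.
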